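(* Let $q$ be a complex number with $0<|q|<1$ and let $a,b,z$ be complex numbers (with $z\neq 0$ and $b\neq 1$) such that $\max(|az|,|b|)<1$. Then \[ \frac{(q,z,q/z)_{\infty}}{1-b} =\sum_{k=-\infty}^{\infty}\big(aq^{1-k}+bq\big)_{\infty}\, \big(z(a+bq^k)\big)_{\infty}\,(-1)^kq^{\binom k2}z^k . \]
   Context: For a complex number $x$, $(x)_\infty=(x;q)_\infty:=\prod_{j\ge0}(1-xq^j)$, and $(x_1,\dots,x_m)_\infty:=(x_1)_\infty\cdots(x_m)_\infty$. Note that $(aq^{1-k}+bq)_\infty$ denotes the $q$-shifted factorial with argument $aq^{1-k}+bq$, i.e. $\prod_{j\ge0}(1-(aq^{1-k}+bq)q^j)$, and similarly $(z(a+bq^k))_\infty=\prod_{j\ge0}(1-z(a+bq^k)q^j)$. *)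

(* Defs.v *)
From Stdlib Require Import Reals ZArith.
From Coquelicot Require Import Coquelicot.
Open Scope C_scope.

Definition Cpowz (x : C) (k : Z) : C :=
  match k with
  | Z0 => 1
  | Zpos p => x ^ Pos.to_nat p
  | Zneg p => / (x ^ Pos.to_nat p)
  end.

Fixpoint qpoch_n (x q : C) (n : nat) : C :=
  match n with
  | O => 1
  | S m => qpoch_n x q m * (1 - x * q ^ m)
  end.

(* (x; q)_oo.  [lim] is a total operator, equal to the limit of the partial
   products whenever they converge, in particular whenever |q| < 1. *)
Definition qpoch (x q : C) : C :=
  @lim C_CompleteNormedModule (filtermap (qpoch_n x q) eventually).

(* k (k - 1) is even, so the division is exact, also for negative k. *)
Definition binom2 (k : Z) : Z := (k * (k - 1) / 2)%Z.

(* The sum of f over all of Z converges to l: the halves k >= 0 and k < 0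
   converge separately, and their sums add up to l. *)
Definition is_bilateral_series (f : Z -> C) (l : C) : Prop :=
  exists lp ln : C,
    is_series (fun n : nat => f (Z.of_nat n)) lp /\
    is_series (fun n : nat => f (- Z.of_nat (S n))%Z) ln /\
    l = lp + ln.

(* Main.v *)
(* Put c_k = a + b q^k, let F(a,b) be the sum of the theorem and G(a,b) the same sum with
   (z c_k)_oo replaced by (z q c_k)_oo.  Splitting off the first factor of one of the two
   infinite products and shifting the summation index gives
     F(a,b) = (1 - z a) G(a,b) + b F(a q, b),
     G(a,b) = (1 - b q) F(a q, b q) + a z G(a, b q).
   In the unknowns (1 - b) F and (1 - z a) G a common constant solves this system, and
   since the system passes from (a,b) to (a q, b q), a solution that is Lipschitz at the
   origin must be that constant.  Hence (1 - b) F(a,b) = F(0,0), a theta series.  The same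
   identity at a = 1, b = 0, where half of the terms vanish, evaluates F(0,0) by Euler's
   expansion of (q/z)_oo: this is the Jacobi triple product. *)
Require Import Defs.
From Stdlib Require Import Reals ZArith Lra Lia.
From Coquelicot Require Import Coquelicot.
Open Scope C_scope.

(** The two size hypotheses enter through convergence: the majorants of the halves k >= 0 and k < 0
    have limiting ratios |a z| and |b|. In the homogeneous system the coefficients b, 1 - b and a z,
    1 - a z add up to 1, but their moduli need not, so no maximum principle makes the difference
    vanish. Moreover each relation contains its own unknown at (a q, b) or (a, b q), where only one
    variable shrinks. That term is eliminated first, by iterating in this variable with contraction
    factor |b| or |a z|. The price is a factor (1 + x) / (1 - x), with x proportional to the current
    polydisc; since the polydiscs shrink geometrically, the total loss stays bounded, and the
    Lipschitz bound of order |q|^n beats it. This is why every estimate of a q-product concerns its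
    distance to 1 and is linear in a radius [r]: the summand must differ from the theta term by at
    most [r] times a summable majorant that does not depend on [r]. *)

(** * Limits of complex sequences *)

Lemma is_lim_seq_le_real (u v : nat -> R) (l m : R) :
  (forall n, (u n <= v n)%R) -> is_lim_seq u l -> is_lim_seq v m -> (l <= m)%R.
Proof.
  intros H Hu Hv.
  exact (is_lim_seq_le u v (Finite l) (Finite m) H Hu Hv).
Qed.

Lemma Cmod_triangle_minus (x y : C) : (Cmod (x - y) <= Cmod x + Cmod y)%R.
Proof.
  replace (x - y) with (x + - y) by ring.
  eapply Rle_trans; [apply Cmod_triangle|]. rewrite Cmod_opp. lra.
Qed.

(** Turns complex limits into real ones, for which squeezing and index shifts are available. *)
Lemma filterlim_Cmod (u : nat -> C) (l : C) :
  filterlim u eventually (locally (T := C_UniformSpace) l) <->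
  is_lim_seq (fun n => Cmod (u n - l)) 0.
Proof.
  split.
  - intros H.
    apply (is_lim_seq_spec _ 0). intros eps.
    pose proof (proj1 (filterlim_locally_ball_norm (U := C_NormedModule) u l) H eps)
      as [N HN].
    exists N. intros n Hn. specialize (HN n Hn).
    unfold ball_norm in HN.
    rewrite Rminus_0_r, Rabs_pos_eq by apply Cmod_ge_0. exact HN.
  - intros H.
    apply (filterlim_locally_ball_norm (U := C_NormedModule)). intros eps.
    destruct (proj2 (is_lim_seq_spec _ 0) H eps) as [N HN].
    exists N. intros n Hn. specialize (HN n Hn). simpl in HN.
    rewrite Rminus_0_r, Rabs_pos_eq in HN by apply Cmod_ge_0. exact HN.
Qed.

Lemma filterlim_C_unique (u : nat -> C) (l m : C) :
  filterlim u eventually (locally (T := C_UniformSpace) l) ->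
  filterlim u eventually (locally (T := C_UniformSpace) m) -> l = m.
Proof. exact (filterlim_locally_unique (V := C_NormedModule) u l m). Qed.

Lemma Cmod_limit_le (u : nat -> C) (l c : C) (M : R) :
  filterlim u eventually (locally (T := C_UniformSpace) l) ->
  (forall n, (Cmod (u n - c) <= M)%R) -> (Cmod (l - c) <= M)%R.
Proof.
  intros H HM. apply filterlim_Cmod in H.
  apply (is_lim_seq_le_real (fun _ => Cmod (l - c)) (fun n => Cmod (u n - l) + M)%R).
  - intros n. eapply Rle_trans; [|apply Rplus_le_compat_l, (HM n)].
    replace (l - c) with ((u n - c) - (u n - l)) by ring.
    eapply Rle_trans; [apply Cmod_triangle_minus|]. lra.
  - apply is_lim_seq_const.
  - replace M with (0 + M)%R at 1 by ring.
    apply (is_lim_seq_plus' _ _ 0 M H). apply is_lim_seq_const.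
Qed.

Lemma filterlim_dominated (u : nat -> C) (l : C) (e : nat -> R) :
  (forall n, (Cmod (u n - l) <= e n)%R) -> is_lim_seq e 0 ->
  filterlim u eventually (locally (T := C_UniformSpace) l).
Proof.
  intros H He. apply filterlim_Cmod.
  apply (is_lim_seq_le_le (fun _ => 0%R) _ e); [|apply is_lim_seq_const|exact He].
  intros n; split; [apply Cmod_ge_0|apply H].
Qed.

Lemma filterlim_Cmult_l (c : C) (u : nat -> C) (l : C) :
  filterlim u eventually (locally (T := C_UniformSpace) l) ->
  filterlim (fun n => c * u n) eventually (locally (T := C_UniformSpace) (c * l)).
Proof.
  intros H. apply filterlim_Cmod in H.
  apply filterlim_dominated with (e := fun n => (Cmod c * Cmod (u n - l))%R).
  - intros n. replace (c * u n - c * l) with (c * (u n - l)) by ring.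
    rewrite Cmod_mult. lra.
  - replace 0%R with (Cmod c * 0)%R by ring.
    apply (is_lim_seq_scal_l _ _ 0 H).
Qed.

(** * Finite q-products and their real majorants *)

(** This is (-s; p)_n, the majorant of (x; q)_n for s = |x| and p = |q|. *)
Fixpoint rpoch (s p : R) (n : nat) : R :=
  match n with
  | O => 1
  | S m => rpoch s p m * (1 + s * p ^ m)
  end%R.

Section PochBounds.
Local Open Scope R_scope.

Lemma rpoch_ge_1 (s p : R) (n : nat) : 0 <= s -> 0 < p -> 1 <= rpoch s p n.
Proof.
  intros Hs Hp. induction n as [|n IH]; simpl; [lra|].
  pose proof (pow_lt p n Hp). assert (0 <= s * p ^ n) by (apply Rmult_le_pos; lra).
  nra.
Qed.

Lemma rpoch_mono (s t p : R) (n : nat) :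
  0 <= s <= t -> 0 < p -> rpoch s p n <= rpoch t p n.
Proof.
  intros Hs Hp. induction n as [|n IH]; simpl; [lra|].
  pose proof (pow_lt p n Hp).
  apply Rmult_le_compat; [|nra|exact IH|nra].
  pose proof (rpoch_ge_1 s p n); lra.
Qed.

Lemma rpoch_add (s p : R) (n m : nat) :
  rpoch s p (n + m) = rpoch s p n * rpoch (s * p ^ n) p m.
Proof.
  induction m as [|m IH]; [rewrite Nat.add_0_r; simpl; ring|].
  rewrite Nat.add_succ_r. simpl. rewrite IH, pow_add. ring.
Qed.

Lemma geom_sum_lt (p : R) (n : nat) : 0 < p < 1 -> (1 - p ^ n) / (1 - p) < / (1 - p).
Proof.
  intros Hp. pose proof (pow_lt p n (proj1 Hp)).
  assert (0 < / (1 - p)) by (apply Rinv_0_lt_compat; lra).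
  unfold Rdiv. nra.
Qed.

Lemma rpoch_le_exp (s p : R) (n : nat) :
  0 <= s -> 0 < p < 1 -> rpoch s p n <= exp (s / (1 - p)).
Proof.
  intros Hs Hp.
  (* The partial geometric sum in the exponent lets the induction close, through 1 + y <= exp y. *)
  assert (H : rpoch s p n <= exp (s * ((1 - p ^ n) / (1 - p)))).
  { induction n as [|n IH].
    - simpl. replace (s * ((1 - 1) / (1 - p))) with 0 by (field; lra).
      rewrite exp_0. lra.
    - simpl rpoch.
      replace (s * ((1 - p ^ S n) / (1 - p)))
        with (s * ((1 - p ^ n) / (1 - p)) + s * p ^ n) by (simpl; field; lra).
      rewrite exp_plus.
      pose proof (pow_lt p n (proj1 Hp)).
      pose proof (rpoch_ge_1 s p n Hs (proj1 Hp)).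
      assert (0 <= s * p ^ n) by (apply Rmult_le_pos; lra).
      apply Rmult_le_compat; [lra|lra|exact IH|apply exp_ineq1_le]. }
  eapply Rle_trans; [exact H|].
  pose proof (geom_sum_lt p n Hp).
  destruct (Rle_lt_or_eq_dec 0 s Hs) as [Hs'|<-].
  - left. apply exp_increasing. unfold Rdiv at 2. nra.
  - right. f_equal. unfold Rdiv. ring.
Qed.

(* [rpoch] is convex in [s] and equals 1 at [s = 0]. *)
Lemma rpoch_scale (r s p : R) (n : nat) :
  0 <= r <= 1 -> 0 <= s -> 0 < p ->
  rpoch (r * s) p n - 1 <= r * (rpoch s p n - 1).
Proof.
  intros Hr Hs Hp. induction n as [|n IH]; simpl; [lra|].
  pose proof (pow_lt p n Hp).
  assert (0 <= s * p ^ n) by (apply Rmult_le_pos; lra).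
  assert (rpoch (r * s) p n <= rpoch s p n) by (apply rpoch_mono; [nra|lra]).
  assert (0 <= r * (s * p ^ n)) by (apply Rmult_le_pos; lra).
  replace (r * s * p ^ n) with (r * (s * p ^ n)) by ring.
  nra.
Qed.

Lemma Cmod_qpoch_n_le (x q : C) (n : nat) :
  Cmod (qpoch_n x q n) <= rpoch (Cmod x) (Cmod q) n.
Proof.
  induction n as [|n IH]; simpl; [rewrite Cmod_1; lra|].
  rewrite Cmod_mult. apply Rmult_le_compat; try apply Cmod_ge_0; [exact IH|].
  eapply Rle_trans; [apply Cmod_triangle_minus|].
  rewrite Cmod_1, Cmod_mult, Cmod_pow. lra.
Qed.

(** As polynomials in x, both products have constant term 1, and the other coefficients of the
    majorant dominate. The induction gets this without expanding. *)
Lemma Cmod_qpoch_n_sub1 (x q : C) (n : nat) :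
  Cmod (qpoch_n x q n - 1) <= rpoch (Cmod x) (Cmod q) n - 1.
Proof.
  induction n as [|n IH]; simpl.
  - replace (1 - 1)%C with (RtoC 0) by ring. rewrite Cmod_0. lra.
  - replace (qpoch_n x q n * (1 - x * q ^ n) - 1)%C
      with ((qpoch_n x q n - 1) - qpoch_n x q n * (x * q ^ n))%C by ring.
    eapply Rle_trans; [apply Cmod_triangle_minus|].
    rewrite !Cmod_mult, Cmod_pow.
    pose proof (Cmod_qpoch_n_le x q n).
    assert (0 <= Cmod x * Cmod q ^ n)
      by (apply Rmult_le_pos; [|apply pow_le]; apply Cmod_ge_0).
    nra.
Qed.

End PochBounds.

(** * Infinite q-products *)

Lemma qpoch_filterlim (x q : C) :
  (0 < Cmod q < 1)%R ->
  filterlim (qpoch_n x q) eventually (locally (T := C_UniformSpace) (qpoch x q)).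
Proof.
  intros Hq.
  (* The increments of the partial products: they telescope, and they are dominated by a geometric
     series because the partial products are bounded. *)
  set (d := fun n => qpoch_n x q n * (- x * q ^ n)).
  assert (Hex : ex_series (V := C_NormedModule) d).
  { apply (ex_series_le (V := C_CompleteNormedModule) d
      (fun n => exp (Cmod x / (1 - Cmod q)) * Cmod x * Cmod q ^ n)%R).
    - intros n.
      change (Cmod (d n) <= exp (Cmod x / (1 - Cmod q)) * Cmod x * Cmod q ^ n)%R.
      unfold d.
      rewrite !Cmod_mult, Cmod_opp, Cmod_pow, Rmult_assoc.
      apply Rmult_le_compat_r.
      + apply Rmult_le_pos; [|apply pow_le]; apply Cmod_ge_0.
      + eapply Rle_trans; [apply Cmod_qpoch_n_le|].
        apply rpoch_le_exp; [apply Cmod_ge_0|exact Hq].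
    - apply (ex_series_scal_l (V := R_NormedModule)), ex_series_geom.
      rewrite Rabs_pos_eq; lra. }
  destruct Hex as [l Hl].
  assert (Hsum : forall n, sum_n (G := C_NormedModule) d n = qpoch_n x q (S n) - 1).
  { induction n as [|n IH].
    - rewrite sum_O. unfold d; simpl. ring.
    - rewrite sum_Sn, IH. unfold d, plus; simpl. ring. }
  assert (Hlim : filterlim (qpoch_n x q) eventually
                   (locally (T := C_UniformSpace) (1 + l))).
  { apply filterlim_Cmod.
    apply (is_lim_seq_incr_1 (fun n => Cmod (qpoch_n x q n - (1 + l)))).
    apply is_lim_seq_ext with (fun n => Cmod (sum_n (G := C_NormedModule) d n - l)).
    - intros n. rewrite Hsum. f_equal. ring.
    - apply filterlim_Cmod. exact Hl. }
  (* Convergence to the value of [lim] comes from completeness, which only asks for the Cauchy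
     property; the limit 1 + [l] just found supplies it. *)
  apply (filterlim_locally (U := C_UniformSpace)). intros eps.
  apply (complete_cauchy (T := C_CompleteNormedModule)
           (filtermap (qpoch_n x q) eventually)).
  - apply filtermap_proper_filter, eventually_filter.
  - intros e. exists (1 + l). unfold filtermap.
    apply (proj1 (filterlim_locally (U := C_UniformSpace) _ _) Hlim e).
Qed.

Lemma qpoch_n_S_l (x q : C) (n : nat) :
  qpoch_n x q (S n) = (1 - x) * qpoch_n (x * q) q n.
Proof.
  induction n as [|n IH]; [simpl; ring|].
  change (qpoch_n x q (S (S n))) with (qpoch_n x q (S n) * (1 - x * q ^ S n)).
  rewrite IH. simpl. ring.
Qed.

Lemma qpoch_step (x q : C) :
  (0 < Cmod q < 1)%R -> qpoch x q = (1 - x) * qpoch (x * q) q.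
Proof.
  intros Hq.
  apply (filterlim_C_unique (fun n => qpoch_n x q (S n))).
  - apply filterlim_Cmod, (is_lim_seq_incr_1 (fun n => Cmod (qpoch_n x q n - _))).
    apply filterlim_Cmod, qpoch_filterlim, Hq.
  - apply filterlim_Cmod.
    apply is_lim_seq_ext
      with (fun n => Cmod ((1 - x) * qpoch_n (x * q) q n - (1 - x) * qpoch (x * q) q)).
    + intros n. rewrite qpoch_n_S_l. reflexivity.
    + apply filterlim_Cmod, filterlim_Cmult_l, qpoch_filterlim, Hq.
Qed.

(** Convexity of the majorant in [s] converts the radius [r] of the argument into a linear factor.
    [U] stays free so that the caller can supply a bound adapted to the index k. *)
Lemma qpoch_sub1_le (x q : C) (r s U : R) :
  (0 < Cmod q < 1)%R -> (0 <= r <= 1)%R -> (0 <= s)%R -> (Cmod x <= r * s)%R ->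
  (forall n, (rpoch s (Cmod q) n <= U)%R) ->
  (Cmod (qpoch x q - 1) <= r * (U - 1))%R.
Proof.
  intros Hq Hr Hs Hx HU.
  apply (Cmod_limit_le (qpoch_n x q)); [apply qpoch_filterlim, Hq|].
  intros n. eapply Rle_trans; [apply Cmod_qpoch_n_sub1|].
  eapply Rle_trans; [apply Rplus_le_compat_r, (rpoch_mono _ (r * s))|].
  - split; [apply Cmod_ge_0|exact Hx].
  - lra.
  - eapply Rle_trans; [apply rpoch_scale; lra|].
    specialize (HU n). apply Rmult_le_compat_l; lra.
Qed.

(** * Dominated series and bilateral series *)

Lemma series_dominated (c : nat -> C) (M : nat -> R) :
  (forall n, (Cmod (c n) <= M n)%R) -> ex_series M ->
  exists l : C, is_series (V := C_NormedModule) c l /\ (Cmod l <= Series M)%R.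
Proof.
  intros H HM.
  destruct (ex_series_le (V := C_CompleteNormedModule) c M H HM) as [l Hl].
  exists l; split; [exact Hl|].
  apply (is_lim_seq_le_real (fun _ => Cmod l)
    (fun n => Cmod (sum_n (G := C_NormedModule) c n - l) + sum_n M n)%R).
  - intros n.
    assert (Hn : (Cmod (sum_n (G := C_NormedModule) c n) <= sum_n M n)%R).
    { induction n as [|n IH]; [rewrite !sum_O; apply H|].
      rewrite !sum_Sn. eapply Rle_trans; [apply Cmod_triangle|].
      apply Rplus_le_compat; [exact IH|apply H]. }
    replace l with (sum_n (G := C_NormedModule) c n
      - (sum_n (G := C_NormedModule) c n - l)) at 1 by ring.
    eapply Rle_trans; [apply Cmod_triangle_minus|]. lra.
  - apply is_lim_seq_const.
  - replace (Series M) with (0 + Series M)%R by ring.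
    apply (is_lim_seq_plus' _ _ 0 (Series M)).
    + apply filterlim_Cmod. exact Hl.
    + exact (Series_correct M HM).
Qed.

Lemma is_series_C_unique (c : nat -> C) (l m : C) :
  is_series (V := C_NormedModule) c l -> is_series (V := C_NormedModule) c m -> l = m.
Proof. apply filterlim_C_unique. Qed.

Lemma bilateral_unique (f : Z -> C) (l m : C) :
  is_bilateral_series f l -> is_bilateral_series f m -> l = m.
Proof.
  intros (lp & ln & Hp & Hn & ->) (mp & mn & Hp' & Hn' & ->).
  rewrite (is_series_C_unique _ _ _ Hp Hp'), (is_series_C_unique _ _ _ Hn Hn').
  reflexivity.
Qed.

Lemma bilateral_ext (f g : Z -> C) (l : C) :
  (forall k, f k = g k) -> is_bilateral_series f l -> is_bilateral_series g l.
Proof.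
  intros H (lp & ln & Hp & Hn & ->). exists lp, ln.
  repeat split; eapply is_series_ext; eauto; intros n; apply H.
Qed.

Lemma bilateral_plus (f g : Z -> C) (l m : C) :
  is_bilateral_series f l -> is_bilateral_series g m ->
  is_bilateral_series (fun k => f k + g k) (l + m).
Proof.
  intros (lp & ln & Hp & Hn & ->) (mp & mn & Hp' & Hn' & ->).
  exists (lp + mp), (ln + mn).
  repeat split; [exact (is_series_plus _ _ _ _ Hp Hp')
                |exact (is_series_plus _ _ _ _ Hn Hn')|ring].
Qed.

Lemma bilateral_scal (c : C) (f : Z -> C) (l : C) :
  is_bilateral_series f l -> is_bilateral_series (fun k => c * f k) (c * l).
Proof.
  intros (lp & ln & Hp & Hn & ->). exists (c * lp), (c * ln).
  repeat split; [exact (is_series_scal (V := C_NormedModule) c _ _ Hp)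
                |exact (is_series_scal (V := C_NormedModule) c _ _ Hn)|ring].
Qed.

(** Only the term at 0 crosses from the nonnegative half to the negative one. *)
Lemma bilateral_shift (f : Z -> C) (l : C) :
  is_bilateral_series f l -> is_bilateral_series (fun k => f (k + 1)%Z) l.
Proof.
  intros (lp & ln & Hp & Hn & ->). exists (lp - f 0%Z), (ln + f 0%Z).
  repeat split.
  - eapply (is_series_ext (V := C_NormedModule) (fun n => f (Z.of_nat (S n)))).
    + intros n. f_equal. lia.
    + apply (is_series_incr_1 (V := C_NormedModule) (fun n => f (Z.of_nat n))).
      replace (plus _ _) with lp; [exact Hp|]. unfold plus; simpl. ring.
  - apply (is_series_decr_1 (V := C_NormedModule)).
    eapply (is_series_ext (V := C_NormedModule) (fun n => f (- Z.of_nat (S n))%Z)).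
    + intros n. f_equal. lia.
    + replace (plus _ _) with ln; [exact Hn|].
      unfold plus, opp; simpl. ring.
  - ring.
Qed.

Definition summableZ (M : Z -> R) : Prop :=
  ex_series (fun n => M (Z.of_nat n)) /\ ex_series (fun n => M (- Z.of_nat (S n))%Z).

Definition massZ (M : Z -> R) : R :=
  (Series (fun n => M (Z.of_nat n)) + Series (fun n => M (- Z.of_nat (S n))%Z))%R.

Lemma bilateral_dominated (f : Z -> C) (M : Z -> R) :
  (forall k, (Cmod (f k) <= M k)%R) -> summableZ M ->
  exists l, is_bilateral_series f l /\ (Cmod l <= massZ M)%R.
Proof.
  intros H [H1 H2].
  destruct (series_dominated (fun n => f (Z.of_nat n)) _ (fun n => H _) H1)
    as (lp & Hp & Bp).
  destruct (series_dominated (fun n => f (- Z.of_nat (S n))%Z) _ (fun n => H _) H2)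
    as (ln & Hn & Bn).
  exists (lp + ln); split; [exists lp, ln; auto|].
  eapply Rle_trans; [apply Cmod_triangle|]. unfold massZ. lra.
Qed.

Lemma bilateral_le (f : Z -> C) (M : Z -> R) (r : R) (l : C) :
  (forall k, (Cmod (f k) <= r * M k)%R) -> summableZ M ->
  is_bilateral_series f l -> (Cmod l <= r * massZ M)%R.
Proof.
  intros H [H1 H2] Hl.
  destruct (bilateral_dominated f (fun k => r * M k)%R H) as (l' & Hl' & Hb).
  - split; apply (ex_series_scal_l (V := R_NormedModule) r); assumption.
  - rewrite (bilateral_unique _ _ _ Hl Hl').
    unfold massZ in Hb |- *. rewrite !Series_scal_l in Hb. lra.
Qed.

(** * Integer powers and [binom2] *)

Lemma Cpowz_nat (x : C) (n : nat) : Cpowz x (Z.of_nat n) = x ^ n.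
Proof.
  destruct n as [|n]; [reflexivity|].
  simpl. rewrite SuccNat2Pos.id_succ. reflexivity.
Qed.

Lemma Cpowz_neg_nat (x : C) (n : nat) : Cpowz x (- Z.of_nat n) = / x ^ n.
Proof.
  destruct n as [|n]; [simpl; field|].
  simpl. rewrite SuccNat2Pos.id_succ. reflexivity.
Qed.

Lemma Z_nat_cases (k : Z) :
  exists n : nat, k = Z.of_nat n \/ k = (- Z.of_nat (S n))%Z.
Proof.
  destruct (Z_lt_le_dec k 0).
  - exists (Z.to_nat (- k - 1)). right. lia.
  - exists (Z.to_nat k). left. lia.
Qed.

Lemma Cpowz_succ (x : C) (k : Z) : x <> 0 -> Cpowz x (k + 1) = x * Cpowz x k.
Proof.
  intros Hx. destruct (Z_nat_cases k) as [n [-> | ->]].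
  - replace (Z.of_nat n + 1)%Z with (Z.of_nat (S n)) by lia.
    rewrite !Cpowz_nat. reflexivity.
  - replace (- Z.of_nat (S n) + 1)%Z with (- Z.of_nat n)%Z by lia.
    rewrite !Cpowz_neg_nat, Cpow_S. field.
    auto using Cpow_nz.
Qed.

Lemma Cpowz_pred (x : C) (k : Z) : x <> 0 -> Cpowz x (k - 1) = Cpowz x k / x.
Proof.
  intros Hx. replace (Cpowz x k) with (Cpowz x (k - 1 + 1)) by (f_equal; lia).
  rewrite Cpowz_succ by exact Hx. field. exact Hx.
Qed.

Lemma Cpowz_add (x : C) (j k : Z) : x <> 0 -> Cpowz x (j + k) = Cpowz x j * Cpowz x k.
Proof.
  intros Hx. revert k. apply Z.peano_ind.
  - rewrite Z.add_0_r. simpl. ring.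
  - intros k IH. replace (j + Z.succ k)%Z with (j + k + 1)%Z by lia.
    rewrite <- Z.add_1_r, !Cpowz_succ, IH by exact Hx. ring.
  - intros k IH. replace (j + Z.pred k)%Z with (j + k - 1)%Z by lia.
    rewrite <- Z.sub_1_r, !Cpowz_pred, IH by exact Hx. field. exact Hx.
Qed.

Lemma Cinv_nz (x : C) : x <> 0 -> / x <> 0.
Proof.
  intros Hx H. assert (E : x * / x = 1) by (apply Cinv_r, Hx).
  rewrite H in E. apply C1_nz. rewrite <- E. ring.
Qed.

Lemma Cpowz_nz (x : C) (k : Z) : x <> 0 -> Cpowz x k <> 0.
Proof.
  intros Hx. destruct (Z_nat_cases k) as [n [-> | ->]].
  - rewrite Cpowz_nat. apply Cpow_nz, Hx.
  - rewrite Cpowz_neg_nat. apply Cinv_nz, Cpow_nz, Hx.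
Qed.

Lemma Cpowz_opp (x : C) (k : Z) : x <> 0 -> Cpowz x (- k) = / Cpowz x k.
Proof.
  intros Hx. pose proof (Cpowz_nz x k Hx) as Hk.
  assert (E : Cpowz x k * Cpowz x (- k) = 1).
  { rewrite <- Cpowz_add by exact Hx. rewrite Z.add_opp_diag_r. reflexivity. }
  rewrite <- (Cmult_1_r (/ _)), <- E. field. exact Hk.
Qed.

Lemma Cpowz_mult (x y : C) (k : Z) :
  x <> 0 -> y <> 0 -> Cpowz (x * y) k = Cpowz x k * Cpowz y k.
Proof.
  intros Hx Hy. destruct (Z_nat_cases k) as [n [-> | ->]].
  - rewrite !Cpowz_nat. apply Cpow_mult_l.
  - rewrite !Cpowz_neg_nat, Cpow_mult_l. field.
    split; apply Cpow_nz; assumption.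
Qed.

Lemma Cpowz_inv (x : C) (k : Z) : x <> 0 -> Cpowz (/ x) k = / Cpowz x k.
Proof.
  intros Hx. destruct (Z_nat_cases k) as [n [-> | ->]].
  - rewrite !Cpowz_nat. apply Cpow_inv, Hx.
  - rewrite !Cpowz_neg_nat, Cpow_inv by exact Hx. reflexivity.
Qed.

Lemma binom2_succ (k : Z) : binom2 (k + 1) = (binom2 k + k)%Z.
Proof.
  unfold binom2.
  replace ((k + 1) * (k + 1 - 1))%Z with (k * (k - 1) + k * 2)%Z by ring.
  rewrite Z.div_add by lia. reflexivity.
Qed.

Lemma binom2_opp (k : Z) : binom2 (- k) = (binom2 k + k)%Z.
Proof.
  rewrite <- binom2_succ. unfold binom2. f_equal. ring.
Qed.

(** * Symmetries and termwise relations of the summand *)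

Definition theta_term (q t : C) (k : Z) : C :=
  Cpowz (-1) k * Cpowz q (binom2 k) * Cpowz t k.

(* The sum of the theorem is [u = q], [v = t = z]; the extra parameters make the
   family stable under the shifts used below and under [k -> -k]. *)
Definition bterm (q a b u v t : C) (k : Z) : C :=
  qpoch (u * Cpowz q (- k) * (a + b * Cpowz q k)) q *
  qpoch (v * (a + b * Cpowz q k)) q * theta_term q t k.

Lemma Cm1_nz : (-1 : C) <> 0.
Proof. intros H. apply (f_equal fst) in H. simpl in H. lra. Qed.

Lemma Cpowz_m1_sq (k : Z) : Cpowz (-1) k * Cpowz (-1) k = 1.
Proof.
  rewrite <- Cpowz_mult by apply Cm1_nz.
  replace (-1 * -1) with (RtoC 1) by ring.
  destruct (Z_nat_cases k) as [n [-> | ->]].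
  - rewrite Cpowz_nat. apply Cpow_1_l.
  - rewrite Cpowz_neg_nat, Cpow_1_l. field.
Qed.

Lemma theta_term_shift (q t : C) (k : Z) :
  q <> 0 -> t <> 0 -> theta_term q t (k + 1) = - t * theta_term q (t * q) k.
Proof.
  intros Hq Ht. unfold theta_term.
  rewrite binom2_succ, (Cpowz_succ (-1)), (Cpowz_succ t), Cpowz_add, Cpowz_mult
    by (assumption || apply Cm1_nz). ring.
Qed.

Lemma theta_term_opp (q t : C) (k : Z) :
  q <> 0 -> t <> 0 -> theta_term q t (- k) = theta_term q (q / t) k.
Proof.
  intros Hq Ht. unfold theta_term, Cdiv.
  rewrite binom2_opp, !Cpowz_opp, Cpowz_add, Cpowz_mult, Cpowz_inv;
    try assumption; try apply Cm1_nz.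
  - replace (/ Cpowz (-1) k) with (Cpowz (-1) k); [ring|].
    pose proof (Cpowz_nz (-1) k Cm1_nz) as Hm.
    rewrite <- (Cmult_1_l (/ _)), <- (Cpowz_m1_sq k). field. exact Hm.
  - apply Cinv_nz, Ht.
Qed.

(** Reflection exchanges the two infinite products, so estimates for k >= 0 also cover k < 0. *)
Lemma bterm_opp (q a b u v t : C) (k : Z) :
  q <> 0 -> t <> 0 -> bterm q a b u v t (- k) = bterm q b a v u (q / t) k.
Proof.
  intros Hq Ht. unfold bterm. rewrite theta_term_opp by assumption.
  rewrite Z.opp_involutive, !Cpowz_opp by exact Hq.
  pose proof (Cpowz_nz q k Hq) as Hk.
  replace (u * Cpowz q k * (a + b * / Cpowz q k)) with (u * (b + a * Cpowz q k))
    by (field; exact Hk).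
  replace (v * (a + b * / Cpowz q k)) with (v * / Cpowz q k * (b + a * Cpowz q k))
    by (field; exact Hk).
  ring.
Qed.

Lemma bterm_shift (q a b u v t : C) (k : Z) :
  q <> 0 -> t <> 0 ->
  bterm q a b u v t (k + 1) = - t * bterm q a (b * q) (u / q) v (t * q) k.
Proof.
  intros Hq Ht. unfold bterm.
  rewrite theta_term_shift by assumption.
  rewrite !Cpowz_opp, Cpowz_succ by assumption.
  pose proof (Cpowz_nz q k Hq) as Hk.
  replace (u * / (q * Cpowz q k) * (a + b * (q * Cpowz q k)))
    with (u / q * / Cpowz q k * (a + b * q * Cpowz q k)) by (field; auto).
  replace (v * (a + b * (q * Cpowz q k))) with (v * (a + b * q * Cpowz q k)) by ring.
  ring.
Qed.

Lemma bterm_scale (q a b u v t : C) (k : Z) :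
  bterm q (a * q) (b * q) u v t k = bterm q a b (u * q) (v * q) t k.
Proof.
  unfold bterm. f_equal. f_equal; f_equal; ring.
Qed.

Lemma theta_term_mulq (q t : C) (k : Z) :
  q <> 0 -> t <> 0 -> theta_term q (t * q) k = Cpowz q k * theta_term q t k.
Proof.
  intros Hq Ht. unfold theta_term. rewrite Cpowz_mult by assumption. ring.
Qed.

(** The first factor of the second product is 1 - v a - v b q^k, and the theta term absorbs q^k by
    passing from t to t q. *)
Lemma bterm_peel_v (q a b u v t : C) (k : Z) :
  (0 < Cmod q < 1)%R -> q <> 0 -> t <> 0 ->
  bterm q a b u v t k =
  (1 - v * a) * bterm q a b u (v * q) t k
  - v * b * bterm q a b u (v * q) (t * q) k.
Proof.
  intros Hq Hq0 Ht. unfold bterm. rewrite theta_term_mulq by assumption.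
  rewrite (qpoch_step (v * _)) by exact Hq.
  replace (v * (a + b * Cpowz q k) * q) with (v * q * (a + b * Cpowz q k)) by ring.
  ring.
Qed.

(** The first factor of the first product is 1 - u b - u a q^(-k), and the theta term absorbs q^(-k)
    by passing from t to t / q. *)
Lemma bterm_peel_u (q a b u v t : C) (k : Z) :
  (0 < Cmod q < 1)%R -> q <> 0 -> t <> 0 ->
  bterm q a b u v t k =
  (1 - u * b) * bterm q a b (u * q) v t k
  - u * a * bterm q a b (u * q) v (t / q) k.
Proof.
  intros Hq Hq0 Ht. unfold bterm.
  assert (Hd : t / q <> 0).
  { intros H. apply Ht. replace t with (t / q * q) by (field; exact Hq0).
    rewrite H. ring. }
  replace (theta_term q t k) with (Cpowz q k * theta_term q (t / q) k).
  2:{ rewrite <- theta_term_mulq by assumption. f_equal. field. exact Hq0. }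
  rewrite (qpoch_step (u * _ * _)) by exact Hq.
  rewrite Cpowz_opp by exact Hq0.
  pose proof (Cpowz_nz q k Hq0) as Hk.
  replace (u * / Cpowz q k * (a + b * Cpowz q k) * q)
    with (u * q * / Cpowz q k * (a + b * Cpowz q k)) by ring.
  field. exact Hk.
Qed.

(** * Summable majorants of the summand *)

Fixpoint ratio_prod (c s k p : R) (n : nat) : R :=
  match n with
  | O => 1
  | S m => ratio_prod c s k p m * (c * (s + k * p ^ S m))
  end%R.

Section Majorants.
Local Open Scope R_scope.

Lemma ratio_prod_pos (c s k p : R) (n : nat) :
  0 < c -> 0 <= s -> 0 < k -> 0 < p -> 0 < ratio_prod c s k p n.
Proof.
  intros Hc Hs Hk Hp. induction n as [|n IH]; [simpl; lra|].
  change (0 < ratio_prod c s k p n * (c * (s + k * p ^ S n))).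
  pose proof (pow_lt p (S n) Hp).
  apply Rmult_lt_0_compat; [exact IH|]. apply Rmult_lt_0_compat; [exact Hc|].
  apply Rplus_le_lt_0_compat; [exact Hs|]. apply Rmult_lt_0_compat; assumption.
Qed.

Lemma ex_series_ratio_prod (c s k p : R) :
  0 < c -> 0 <= s -> 0 < k -> 0 < p < 1 -> c * s < 1 ->
  ex_series (ratio_prod c s k p).
Proof.
  intros Hc Hs Hk Hp Hcs.
  assert (Hpos : forall n, 0 < ratio_prod c s k p n)
    by (intros n; apply ratio_prod_pos; lra).
  apply ex_series_ext with (fun n => Rabs (ratio_prod c s k p n)).
  { intros n. apply Rabs_pos_eq, Rlt_le, Hpos. }
  apply ex_series_DAlembert with (c * s); [exact Hcs| |].
  { intros n. apply Rgt_not_eq, Hpos. }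
  apply is_lim_seq_ext with (fun n => c * s + c * k * p ^ S n).
  { intros n. rewrite Rabs_pos_eq.
    - simpl. field. apply Rgt_not_eq, Hpos.
    - apply Rlt_le, Rdiv_lt_0_compat; apply Hpos. }
  replace (Finite (c * s)) with (Finite (c * s + c * k * 0)) by (f_equal; ring).
  apply is_lim_seq_plus'; [apply is_lim_seq_const|].
  apply (is_lim_seq_scal_l (fun n => p ^ S n) (c * k) 0).
  apply (is_lim_seq_incr_1 (fun n => p ^ n)).
  apply is_lim_seq_geom. rewrite Rabs_pos_eq; lra.
Qed.

(** The parameter [s'] may depend on [n] through a multiple of p^n. Since p^n <= p^j for every
    factor j <= n, this excess is moved into the coefficient [k], leaving a majorant uniform in
    [n]. *)
Lemma ratio_prod_mono (c s s' k p : R) (n m : nat) :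
  0 <= c -> 0 <= s -> 0 < p < 1 -> 1 <= k -> (m <= n)%nat ->
  s' <= s + (k - 1) * p ^ n -> 0 <= s' ->
  0 <= ratio_prod c s' 1 p m <= ratio_prod c s k p m.
Proof.
  intros Hc Hs Hp Hk Hmn Hs' Hs0. induction m as [|m IH]; [simpl; lra|].
  assert (Hpm : 0 < p ^ S m) by (apply pow_lt; lra).
  assert (Hle : p ^ n <= p ^ S m).
  { replace n with (S m + (n - S m))%nat by lia. rewrite pow_add.
    assert (p ^ (n - S m) <= 1).
    { rewrite <- (pow1 (n - S m)). apply pow_incr. lra. }
    nra. }
  change (ratio_prod c s' 1 p (S m))
    with (ratio_prod c s' 1 p m * (c * (s' + 1 * p ^ S m))).
  change (ratio_prod c s k p (S m))
    with (ratio_prod c s k p m * (c * (s + k * p ^ S m))).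
  destruct IH as [IH1 IH2]; [lia|].
  assert (0 <= c * (s' + 1 * p ^ S m)) by (apply Rmult_le_pos; lra).
  split; [apply Rmult_le_pos; assumption|].
  apply Rmult_le_compat; [assumption|assumption|exact IH2|].
  apply Rmult_le_compat_l; [exact Hc|]. nra.
Qed.

Lemma rpoch_S_l (s p : R) (n : nat) : rpoch s p (S n) = (1 + s) * rpoch (s * p) p n.
Proof.
  change (S n) with (1 + n)%nat. rewrite rpoch_add. simpl.
  rewrite !Rmult_1_r. ring.
Qed.

(** The growing product of the 1 + s p^(-j), for 1 <= j <= n, is tamed by the quadratic power of q:
    each p^(-j) cancels, and the factors become (c / p) (s + p^j). *)
Lemma rpoch_ratio_prod (q : C) (s c : R) (n : nat) :
  q <> 0%C ->
  rpoch (s / Cmod q ^ n) (Cmod q) n * Cmod (Cpowz q (binom2 (Z.of_nat n))) * c ^ n =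
  ratio_prod (c / Cmod q) s 1 (Cmod q) n.
Proof.
  intros Hq. assert (Hp : 0 < Cmod q) by (apply Cmod_gt_0, Hq).
  induction n as [|n IH].
  - simpl. rewrite Cmod_1. ring.
  - rewrite rpoch_S_l, Nat2Z.inj_succ, <- Z.add_1_r, binom2_succ, Cpowz_add by exact Hq.
    rewrite Cmod_mult, Cpowz_nat, Cmod_pow.
    change (ratio_prod (c / Cmod q) s 1 (Cmod q) (S n))
      with (ratio_prod (c / Cmod q) s 1 (Cmod q) n
            * (c / Cmod q * (s + 1 * Cmod q ^ S n))).
    rewrite <- IH.
    assert (Hn : Cmod q ^ n <> 0) by (apply pow_nonzero; lra).
    replace (s / Cmod q ^ S n * Cmod q) with (s / Cmod q ^ n)
      by (simpl; field; lra).
    simpl. field. lra.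
Qed.

(** Cuts the product at [n]. With s / p^n for [s], the first [n] factors are those that the theta
    term compensates, and the exponential for the rest no longer contains p^n. *)
Lemma rpoch_split_le (s p : R) (n m : nat) :
  0 <= s -> 0 < p < 1 ->
  rpoch s p m <= rpoch s p n * exp (s * p ^ n / (1 - p)).
Proof.
  intros Hs Hp.
  assert (Hn : 0 < p ^ n) by (apply pow_lt; lra).
  assert (Hm : rpoch s p m <= rpoch s p (n + m)).
  { rewrite Nat.add_comm, rpoch_add.
    assert (Hpm : 0 < p ^ m) by (apply pow_lt; lra).
    assert (0 <= s * p ^ m) by (apply Rmult_le_pos; lra).
    pose proof (rpoch_ge_1 s p m Hs (proj1 Hp)).
    pose proof (rpoch_ge_1 (s * p ^ m) p n H (proj1 Hp)). nra. }
  eapply Rle_trans; [exact Hm|]. rewrite rpoch_add.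
  apply Rmult_le_compat_l.
  - pose proof (rpoch_ge_1 s p n Hs (proj1 Hp)). lra.
  - apply rpoch_le_exp; [apply Rmult_le_pos; lra|exact Hp].
Qed.

(** The two exponentials bound the tail of the first product and the whole second product;
    [ratio_prod] bounds the first [n] factors of the first product times the theta term. *)
Definition bmajor (p A B u v t : R) (n : nat) : R :=
  exp (u * (A + B) / (1 - p)) * exp (v * (A + B) / (1 - p))
  * ratio_prod (t / p) (u * A) (1 + u * B) p n.

Lemma ex_series_bmajor (p A B u v t : R) :
  0 < p < 1 -> 0 <= A -> 0 <= B -> 0 <= u -> 0 < t -> t * (u * A) < p ->
  ex_series (bmajor p A B u v t).
Proof.
  intros Hp HA HB Hu Ht Hc.
  apply (ex_series_scal_l (V := R_NormedModule)), ex_series_ratio_prod.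
  - apply Rdiv_lt_0_compat; lra.
  - apply Rmult_le_pos; assumption.
  - pose proof (Rmult_le_pos u B Hu HB). lra.
  - exact Hp.
  - replace (t / p * (u * A)) with (t * (u * A) / p) by (field; lra).
    apply (Rmult_lt_reg_r p); [lra|]. unfold Rdiv.
    rewrite Rmult_assoc, Rinv_l; lra.
Qed.

Lemma exp_le (x y : R) : x <= y -> exp x <= exp y.
Proof.
  intros [H| ->]; [left; apply exp_increasing, H|right; reflexivity].
Qed.

(** Both x y - 1 and U V - 1 expand in the deviations from 1; the quadratic term gains r^2 <= r. *)
Lemma product_sub1_le (x y : C) (r U V : R) :
  0 <= r <= 1 -> 1 <= U -> 1 <= V ->
  Cmod (x - 1) <= r * (U - 1) -> Cmod (y - 1) <= r * (V - 1) ->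
  Cmod (x * y - 1) <= r * (U * V - 1).
Proof.
  intros Hr HU HV Hx Hy.
  replace (x * y - 1)%C with ((x - 1) * (y - 1) + ((x - 1) + (y - 1)))%C by ring.
  eapply Rle_trans; [apply Cmod_triangle|].
  eapply Rle_trans; [apply Rplus_le_compat_l, Cmod_triangle|].
  rewrite Cmod_mult.
  pose proof (Cmod_ge_0 (x - 1)). pose proof (Cmod_ge_0 (y - 1)).
  assert (Cmod (x - 1) * Cmod (y - 1) <= r * (U - 1) * (r * (V - 1)))
    by (apply Rmult_le_compat; assumption).
  assert (0 <= (U - 1) * (V - 1)) by (apply Rmult_le_pos; lra).
  assert (r * (U - 1) * (r * (V - 1)) <= r * ((U - 1) * (V - 1))).
  { replace (r * (U - 1) * (r * (V - 1))) with (r * r * ((U - 1) * (V - 1))) by ring.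
    apply Rmult_le_compat_r; nra. }
  nra.
Qed.

Lemma bterm_nat_bound (q a b u v t : C) (A B r : R) (n : nat) :
  0 < Cmod q < 1 -> t <> 0%C -> 0 <= A -> 0 <= B -> 0 <= r <= 1 ->
  Cmod a <= r * A -> Cmod b <= r * B ->
  Cmod (bterm q a b u v t (Z.of_nat n) - theta_term q t (Z.of_nat n))
    <= r * bmajor (Cmod q) A B (Cmod u) (Cmod v) (Cmod t) n /\
  Cmod (theta_term q t (Z.of_nat n))
    <= bmajor (Cmod q) A B (Cmod u) (Cmod v) (Cmod t) n.
Proof.
  intros Hq Ht HA HB Hr Ha Hb.
  assert (Hq0 : q <> 0%C) by (apply Cmod_gt_0; lra).
  assert (Hpn : 0 < Cmod q ^ n) by (apply pow_lt; lra).
  assert (Hpn1 : Cmod q ^ n <= 1)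
    by (rewrite <- (pow1 n); apply pow_incr; lra).
  pose proof (Cmod_ge_0 u) as Hu. pose proof (Cmod_ge_0 v) as Hv.
  assert (HBn : 0 <= B * Cmod q ^ n <= B) by nra.
  set (s := Cmod u * (A + B * Cmod q ^ n)).
  assert (Hs : 0 <= s) by (apply Rmult_le_pos; lra).
  assert (Hc : Cmod (a + b * q ^ n) <= r * (A + B * Cmod q ^ n)).
  { eapply Rle_trans; [apply Cmod_triangle|]. rewrite Cmod_mult, Cmod_pow.
    pose proof (Rmult_le_compat_r _ _ _ (Rlt_le _ _ Hpn) Hb). lra. }
  set (U := rpoch (s / Cmod q ^ n) (Cmod q) n * exp (Cmod u * (A + B) / (1 - Cmod q))).
  set (V := exp (Cmod v * (A + B) / (1 - Cmod q))).
  assert (Hsn : 0 <= s / Cmod q ^ n)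
    by (apply Rmult_le_pos; [exact Hs|left; apply Rinv_0_lt_compat, Hpn]).
  assert (Hi : 0 < / (1 - Cmod q)) by (apply Rinv_0_lt_compat; lra).
  assert (H1 : Cmod (qpoch (u * Cpowz q (- Z.of_nat n) * (a + b * q ^ n)) q - 1)
                 <= r * (U - 1)).
  { apply (qpoch_sub1_le _ _ r (s / Cmod q ^ n)); try assumption.
    - rewrite !Cmod_mult, Cpowz_neg_nat, Cmod_inv, Cmod_pow by (apply Cpow_nz, Hq0).
      unfold s. assert (0 < / Cmod q ^ n) by (apply Rinv_0_lt_compat, Hpn).
      assert (0 <= Cmod u * / Cmod q ^ n) by (apply Rmult_le_pos; lra).
      unfold Rdiv. nra.
    - intros m. eapply Rle_trans; [apply (rpoch_split_le _ _ n m Hsn Hq)|].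
      apply Rmult_le_compat_l.
      + pose proof (rpoch_ge_1 (s / Cmod q ^ n) (Cmod q) n Hsn (proj1 Hq)). lra.
      + apply exp_le. apply Rmult_le_compat_r; [lra|].
        replace (s / Cmod q ^ n * Cmod q ^ n) with s by (field; lra).
        unfold s. apply Rmult_le_compat_l; lra. }
  assert (H2 : Cmod (qpoch (v * (a + b * q ^ n)) q - 1) <= r * (V - 1)).
  { apply (qpoch_sub1_le _ _ r (Cmod v * (A + B))); try assumption.
    - apply Rmult_le_pos; lra.
    - rewrite Cmod_mult.
      apply Rle_trans with (Cmod v * (r * (A + B))); [|right; ring].
      apply Rmult_le_compat_l; [exact Hv|]. nra.
    - intros m. apply rpoch_le_exp; [apply Rmult_le_pos; lra|exact Hq]. }
  assert (HE : forall w, 0 <= w -> 1 <= exp (w * (A + B) / (1 - Cmod q))).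
  { intros w Hw. apply Rle_trans with (exp 0); [rewrite exp_0; lra|]. apply exp_le.
    apply Rmult_le_pos; [apply Rmult_le_pos; lra|left; exact Hi]. }
  assert (HP := rpoch_ge_1 (s / Cmod q ^ n) (Cmod q) n Hsn (proj1 Hq)).
  assert (HU : 1 <= U).
  { unfold U. pose proof (HE _ Hu). nra. }
  assert (HV : 1 <= V) by (apply HE, Hv).
  unfold bterm. rewrite Cpowz_nat.
  set (x := qpoch (u * _ * _) q) in *. set (y := qpoch (v * _) q) in *.
  pose proof (product_sub1_le x y r U V Hr HU HV H1 H2) as H3.
  replace (x * y * theta_term q t (Z.of_nat n) - theta_term q t (Z.of_nat n))%C
    with ((x * y - 1) * theta_term q t (Z.of_nat n))%C by ring.
  rewrite Cmod_mult.
  assert (Hth : Cmod (theta_term q t (Z.of_nat n))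
                = Cmod (Cpowz q (binom2 (Z.of_nat n))) * Cmod t ^ n).
  { unfold theta_term. rewrite !Cmod_mult, !Cpowz_nat, !Cmod_pow.
    replace (Cmod (-1)) with 1.
    - rewrite pow1. ring.
    - rewrite Cmod_R, Rabs_left; lra. }
  rewrite Hth. set (W := Cmod (Cpowz q _) * _).
  assert (HW : 0 <= W)
    by (apply Rmult_le_pos; [apply Cmod_ge_0|apply pow_le, Cmod_ge_0]).
  assert (HM : U * V * W <= bmajor (Cmod q) A B (Cmod u) (Cmod v) (Cmod t) n).
  { unfold U, V, W, bmajor.
    assert (HR : rpoch (s / Cmod q ^ n) (Cmod q) n
        * Cmod (Cpowz q (binom2 (Z.of_nat n))) * Cmod t ^ n
      <= ratio_prod (Cmod t / Cmod q) (Cmod u * A) (1 + Cmod u * B) (Cmod q) n).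
    { rewrite rpoch_ratio_prod by exact Hq0.
      apply ratio_prod_mono with (n := n); try lia; try lra.
      - apply Rmult_le_pos; [apply Cmod_ge_0|left; apply Rinv_0_lt_compat; lra].
      - apply Rmult_le_pos; lra.
      - assert (0 <= Cmod u * B) by (apply Rmult_le_pos; lra). lra.
      - unfold s. right. ring. }
    set (E1 := exp (Cmod u * _ / _)). set (E2 := exp (Cmod v * _ / _)).
    assert (0 <= E1 * E2) by (apply Rmult_le_pos; left; apply exp_pos).
    apply Rmult_le_compat_l with (r := E1 * E2) in HR; [|assumption].
    eapply Rle_trans; [|exact HR]. right. ring. }
  split.
  - apply Rle_trans with (r * (U * V - 1) * W).
    { apply Rmult_le_compat_r; assumption. }
    rewrite Rmult_assoc. apply Rmult_le_compat_l; [lra|]. nra.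
  - assert (1 <= U * V) by nra. nra.
Qed.

(** The two strict inequalities make the limiting ratios at +oo and -oo less than 1. [M] is chosen
    before [r], [a] and [b], so the estimate is Lipschitz at the origin, uniformly on the
    polydisc. *)
Lemma bterm_majorant (q u v t : C) (A B : R) :
  0 < Cmod q < 1 -> t <> 0%C -> 0 <= A -> 0 <= B ->
  Cmod t * (Cmod u * A) < Cmod q -> Cmod v * B < Cmod t ->
  exists M : Z -> R, summableZ M /\
    forall (r : R) (a b : C) (k : Z), 0 <= r <= 1 ->
      Cmod a <= r * A -> Cmod b <= r * B ->
      Cmod (bterm q a b u v t k - theta_term q t k) <= r * M k /\
      Cmod (theta_term q t k) <= M k.
Proof.
  intros Hq Ht HA HB Hc1 Hc2.
  assert (Hq0 : q <> 0%C) by (apply Cmod_gt_0; lra).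
  assert (Htp : 0 < Cmod t) by (apply Cmod_gt_0, Ht).
  set (M1 := bmajor (Cmod q) A B (Cmod u) (Cmod v) (Cmod t)).
  set (M2 := bmajor (Cmod q) B A (Cmod v) (Cmod u) (Cmod (q / t))).
  assert (Hqt : (q / t)%C <> 0%C).
  { apply Cmult_neq_0; [exact Hq0|apply Cinv_nz, Ht]. }
  exists (fun k => if (k <? 0)%Z then M2 (Z.to_nat (- k)) else M1 (Z.to_nat k)).
  split; [split|].
  - eapply ex_series_ext; [|apply ex_series_bmajor with (p := Cmod q) (A := A)
      (B := B) (u := Cmod u) (v := Cmod v) (t := Cmod t); try assumption;
      apply Cmod_ge_0].
    intros n. simpl. rewrite (proj2 (Z.ltb_ge _ _)) by lia.
    rewrite Nat2Z.id. reflexivity.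
  - apply ex_series_ext with (fun n => M2 (S n)).
    + intros n. rewrite (proj2 (Z.ltb_lt _ _)) by lia. f_equal. lia.
    + apply (ex_series_incr_1 (V := R_NormedModule) M2).
      apply ex_series_bmajor; try assumption; try apply Cmod_ge_0.
      * apply Cmod_gt_0, Hqt.
      * rewrite Cmod_div by exact Ht.
        replace (Cmod q / Cmod t * (Cmod v * B))
          with (Cmod q * (Cmod v * B / Cmod t)) by (field; lra).
        assert (Cmod v * B / Cmod t < 1).
        { apply (Rmult_lt_reg_r (Cmod t)); [exact Htp|].
          unfold Rdiv. rewrite Rmult_assoc, Rinv_l; lra. }
        nra.
  - intros r a b k Hr Ha Hb. destruct (Z.ltb_spec k 0) as [Hk|Hk].
    + replace k with (- Z.of_nat (Z.to_nat (- k)))%Z at 1 2 4 by lia.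
      rewrite bterm_opp, !theta_term_opp by assumption.
      apply bterm_nat_bound; assumption.
    + replace k with (Z.of_nat (Z.to_nat k)) at 1 2 4 by lia.
      apply bterm_nat_bound; assumption.
Qed.

End Majorants.

(** * Vanishing of solutions of the homogeneous system *)

Section Contraction.
Local Open Scope R_scope.

(** Iterating [n] times leaves c^n times a constant plus the sum of a geometric series. The a priori
    bound [M] only serves to let the first part tend to 0, so it is absent from the result. *)
Lemma bound_contraction {T : Type} (S : T -> Prop) (g : T -> T) (h : T -> R)
  (c X M : R) :
  0 <= c < 1 -> (forall x, S x -> S (g x)) ->
  (forall x, S x -> h x <= M) ->
  (forall x, S x -> h x <= c * h (g x) + X) ->
  forall x, S x -> h x <= X / (1 - c).
Proof.
  intros Hc Hg HM Hstep.
  assert (H : forall n x, S x -> h x <= c ^ n * (M - X / (1 - c)) + X / (1 - c)).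
  { induction n as [|n IH]; intros x Hx.
    - simpl. specialize (HM x Hx). lra.
    - eapply Rle_trans; [apply Hstep, Hx|].
      specialize (IH (g x) (Hg x Hx)).
      apply Rle_trans
        with (c * (c ^ n * (M - X / (1 - c)) + X / (1 - c)) + X).
      + apply Rplus_le_compat_r, Rmult_le_compat_l; lra.
      + right. simpl. field. lra. }
  intros x Hx.
  apply (is_lim_seq_le_real (fun _ => h x)
    (fun n => c ^ n * (M - X / (1 - c)) + X / (1 - c))).
  - intros n. apply H, Hx.
  - apply is_lim_seq_const.
  - replace (Finite (X / (1 - c)))
      with (Finite (0 * (M - X / (1 - c)) + X / (1 - c))) by (f_equal; ring).
    apply is_lim_seq_plus'; [|apply is_lim_seq_const].
    apply (is_lim_seq_mult' (fun n => c ^ n) (fun _ => M - X / (1 - c)) 0 _);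
      [|apply is_lim_seq_const].
    apply is_lim_seq_geom. rewrite Rabs_pos_eq; lra.
Qed.

Lemma ratio_le_exp (x c : R) :
  0 <= x <= c -> c < 1 -> (1 + x) / (1 - x) <= exp (2 / (1 - c) * x).
Proof.
  intros Hx Hc.
  eapply Rle_trans; [|apply exp_ineq1_le].
  assert (0 < / (1 - x)) by (apply Rinv_0_lt_compat; lra).
  assert (/ (1 - x) <= / (1 - c)) by (apply Rinv_le_contravar; lra).
  replace ((1 + x) / (1 - x)) with (1 + 2 * x * / (1 - x)) by (field; lra).
  replace (2 / (1 - c) * x) with (2 * x * / (1 - c)) by (field; lra).
  apply Rplus_le_compat_l, Rmult_le_compat_l; lra.
Qed.

(* One round of both relations passes from the polydisc of radii [r A, r B] to the
   one of radii [|q| r A, |q| r B] at the cost of a factor [exp (2 l r)]; these factors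
   have a bounded product, while [f] shrinks like [|q|^n] after [n] rounds. *)
Lemma system_vanishes (q z : C) (f g : C -> C -> C) (A B c M : R) :
  0 < Cmod q < 1 -> 0 <= A -> 0 <= B -> A * Cmod z <= c -> B <= c -> c < 1 ->
  (forall a b, Cmod a <= A -> Cmod b <= B ->
     f a b = (b * f (a * q) b + (1 - b) * g a b)%C) ->
  (forall a b, Cmod a <= A -> Cmod b <= B ->
     g a b = (a * z * g a (b * q) + (1 - a * z) * f (a * q) (b * q))%C) ->
  (forall a b, Cmod a <= A -> Cmod b <= B -> Cmod (g a b) <= M) ->
  (forall r a b, 0 <= r <= 1 -> Cmod a <= r * A -> Cmod b <= r * B ->
     Cmod (f a b) <= r * M) ->
  forall a b, Cmod a <= A -> Cmod b <= B -> f a b = 0%C.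
Proof.
  intros Hq HA HB HAz HBc Hc Hf Hg HgM HfM.
  assert (Hscale : forall (x : C) s, Cmod x <= s -> Cmod (x * q) <= s).
  { intros x s Hx. rewrite Cmod_mult. pose proof (Cmod_ge_0 x). nra. }
  pose proof (Cmod_ge_0 z) as Hz.
  assert (HAz0 : 0 <= A * Cmod z) by (apply Rmult_le_pos; assumption).
  (* The rate from [ratio_le_exp]: at x = r c each of the two relations costs at most exp (l r). *)
  set (l := 2 / (1 - c)).
  assert (Hl : 0 < l) by (apply Rdiv_lt_0_compat; lra).
  assert (Hround : forall r e, 0 <= r <= 1 -> 0 <= e ->
    (forall a b, Cmod a <= Cmod q * r * A -> Cmod b <= Cmod q * r * B ->
       Cmod (f a b) <= e) ->
    forall a b, Cmod a <= r * A -> Cmod b <= r * B ->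
      Cmod (f a b) <= e * exp (2 * l * r)).
  { intros r e Hr He IH.
    assert (HrA : r * A <= A) by nra. assert (HrB : r * B <= B) by nra.
    assert (HrA0 : 0 <= r * A) by nra. assert (HrB0 : 0 <= r * B) by nra.
    assert (Hx : 0 <= r * (A * Cmod z) <= r * c) by (split; nra).
    assert (Hrc : r * c <= c) by nra.
    assert (HgB : forall a b, Cmod a <= r * A -> Cmod b <= r * B ->
              Cmod (g a b) <= e * exp (l * r)).
    { intros a b Ha Hb.
      (* With [a] fixed, iterate the relation for [g] along b, b q, b q^2, ...; its source term f (a
         q) (b q) lies in the smaller polydisc, where [e] bounds it. *)
      apply Rle_trans with ((1 + r * c) * e / (1 - r * c)).
      - apply (bound_contraction (fun y => Cmod y <= r * B) (fun y => (y * q)%C)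
          (fun y => Cmod (g a y)) (r * c) ((1 + r * c) * e) M); try assumption.
        + lra.
        + intros y Hy. apply Hscale; assumption.
        + intros y Hy. apply HgM; lra.
        + intros y Hy. rewrite (Hg a y) by lra.
          eapply Rle_trans; [apply Cmod_triangle|]. rewrite (Cmod_mult (a * z)).
          assert (Haz : Cmod (a * z) <= r * c).
          { rewrite Cmod_mult. eapply Rle_trans; [|apply Hx].
            rewrite <- Rmult_assoc. apply Rmult_le_compat_r; assumption. }
          apply Rplus_le_compat.
          * apply Rmult_le_compat_r; [apply Cmod_ge_0|exact Haz].
          * rewrite Cmod_mult. apply Rmult_le_compat; try apply Cmod_ge_0.
            { eapply Rle_trans; [apply Cmod_triangle_minus|]. rewrite Cmod_1. lra. }
            apply IH; rewrite Cmod_mult, Rmult_comm, Rmult_assoc;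
              apply Rmult_le_compat_l; lra.
      - replace ((1 + r * c) * e / (1 - r * c)) with (e * ((1 + r * c) / (1 - r * c)))
          by (field; lra).
        apply Rmult_le_compat_l; [exact He|].
        eapply Rle_trans; [apply (ratio_le_exp _ c); lra|].
        apply exp_le, Rmult_le_compat_l; [lra|nra]. }
    intros a b Ha Hb.
    set (e' := e * exp (l * r)) in *.
    assert (He' : 0 <= e') by (apply Rmult_le_pos; [exact He|left; apply exp_pos]).
    (* Now [b] is fixed and the relation for [f] is iterated in [a], with the bound on [g] just
       obtained as source. *)
    apply Rle_trans with ((1 + r * c) * e' / (1 - r * c)).
    - apply (bound_contraction (fun x => Cmod x <= r * A) (fun x => (x * q)%C)
        (fun x => Cmod (f x b)) (r * c) ((1 + r * c) * e') (r * M)); try assumption.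
      + lra.
      + intros x Hx'. apply Hscale; assumption.
      + intros x Hx'. apply HfM; assumption.
      + intros x Hx'. rewrite (Hf x b) by lra.
        assert (Hbc : Cmod b <= r * c) by nra.
        eapply Rle_trans; [apply Cmod_triangle|].
        rewrite (Cmod_mult b), (Cmod_mult (1 - b)).
        apply Rplus_le_compat.
        * apply Rmult_le_compat_r; [apply Cmod_ge_0|exact Hbc].
        * apply Rmult_le_compat; try apply Cmod_ge_0.
          { eapply Rle_trans; [apply Cmod_triangle_minus|]. rewrite Cmod_1. lra. }
          apply HgB; assumption.
    - replace ((1 + r * c) * e' / (1 - r * c)) with (e' * ((1 + r * c) / (1 - r * c)))
        by (field; lra).
      apply Rle_trans with (e' * exp (l * r)).
      + apply Rmult_le_compat_l; [exact He'|].
        eapply Rle_trans; [apply (ratio_le_exp _ c); lra|].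
        apply exp_le, Rmult_le_compat_l; [lra|nra].
      + unfold e'. rewrite Rmult_assoc, <- exp_plus. right. f_equal. f_equal. ring. }
  assert (Hrounds : forall n r e, 0 <= r <= 1 -> 0 <= e ->
    (forall a b, Cmod a <= Cmod q ^ n * r * A -> Cmod b <= Cmod q ^ n * r * B ->
       Cmod (f a b) <= e) ->
    forall a b, Cmod a <= r * A -> Cmod b <= r * B ->
      Cmod (f a b) <= e * exp (2 * l * r / (1 - Cmod q))).
  { induction n as [|n IH]; intros r e Hr He H a b Ha Hb.
    - apply Rle_trans with (e * 1).
      + rewrite Rmult_1_r. apply H; simpl; rewrite Rmult_1_l; assumption.
      + apply Rmult_le_compat_l; [exact He|].
        apply Rle_trans with (exp 0); [rewrite exp_0; lra|]. apply exp_le.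
        apply Rmult_le_pos; [nra|left; apply Rinv_0_lt_compat; lra].
    (* The exponents form a geometric series: 2 l r plus the total for radius |q| r is the total for
       radius r. *)
    - replace (e * exp (2 * l * r / (1 - Cmod q)))
        with (e * exp (2 * l * (Cmod q * r) / (1 - Cmod q)) * exp (2 * l * r)).
      2:{ rewrite Rmult_assoc, <- exp_plus. f_equal. f_equal. field. lra. }
      apply Hround; try assumption.
      { apply Rmult_le_pos; [exact He|left; apply exp_pos]. }
      apply IH; [nra|exact He|].
      intros x y Hx Hy. apply H.
      + eapply Rle_trans; [exact Hx|]. right. simpl. ring.
      + eapply Rle_trans; [exact Hy|]. right. simpl. ring. }
  intros a b Ha Hb. apply Cmod_eq_0. apply Rle_antisym; [|apply Cmod_ge_0].
  assert (HM : 0 <= M).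
  { eapply Rle_trans; [|apply (HgM a b Ha Hb)]. apply Cmod_ge_0. }
  set (K := exp (2 * l * 1 / (1 - Cmod q))).
  (* The innermost polydisc has radius |q|^n, so the Lipschitz bound starts the [n] rounds with e =
     |q|^n M. *)
  apply (is_lim_seq_le_real (fun _ => Cmod (f a b)) (fun n => Cmod q ^ n * (M * K))).
  - intros n. rewrite <- Rmult_assoc.
    assert (Hn : 0 < Cmod q ^ n) by (apply pow_lt; lra).
    assert (Hn1 : Cmod q ^ n <= 1) by (rewrite <- (pow1 n); apply pow_incr; lra).
    apply (Hrounds n 1); [lra|nra| |lra|lra].
    intros x y Hx Hy. rewrite Rmult_1_r in Hx, Hy. apply HfM; [lra|assumption|assumption].
  - apply is_lim_seq_const.
  - replace (Finite 0) with (Finite (0 * (M * K))) by (f_equal; ring).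
    apply (is_lim_seq_mult' (fun n => Cmod q ^ n) (fun _ => M * K) 0 _);
      [|apply is_lim_seq_const].
    apply is_lim_seq_geom. rewrite Rabs_pos_eq; lra.
Qed.

End Contraction.

(** * The sums F and G and their relations *)

(** A total sum operator, so that F and G are functions of all a and b, as the abstract system
    requires; its value is used only where convergence is proved. *)
Definition sumZ (f : Z -> C) : C :=
  @iota C_CompleteNormedModule (is_bilateral_series f).

Lemma sumZ_unique (f : Z -> C) (l : C) : is_bilateral_series f l -> sumZ f = l.
Proof.
  intros H. apply (iota_unique (V := C_CompleteNormedModule)); [|exact H].
  intros y Hy. exact (bilateral_unique f y l Hy H).
Qed.

Lemma theta_summable (q t : C) :
  (0 < Cmod q < 1)%R -> t <> 0 ->
  is_bilateral_series (theta_term q t) (sumZ (theta_term q t)).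
Proof.
  intros Hq Ht.
  (* At zero radii the convergence conditions hold for every nonzero [t]. *)
  destruct (bterm_majorant q 0 0 t 0 0) as (M & HM & H); try assumption; try lra.
  - rewrite Rmult_0_r. apply Cmod_gt_0, Ht.
  - destruct (bilateral_dominated (theta_term q t) M) as (l & Hl & _); [|exact HM|].
    + intros k. refine (proj2 (H 0%R 0 0 k _ _ _)); rewrite ?Cmod_0; lra.
    + rewrite (sumZ_unique _ _ Hl). exact Hl.
Qed.

Lemma bterm_sums (q u v t : C) (A B : R) :
  (0 < Cmod q < 1)%R -> t <> 0 -> (0 <= A)%R -> (0 <= B)%R ->
  (Cmod t * (Cmod u * A) < Cmod q)%R -> (Cmod v * B < Cmod t)%R ->
  exists K : R, (0 <= K)%R /\ forall (r : R) (a b : C), (0 <= r <= 1)%R ->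
    (Cmod a <= r * A)%R -> (Cmod b <= r * B)%R ->
    is_bilateral_series (bterm q a b u v t) (sumZ (bterm q a b u v t)) /\
    (Cmod (sumZ (bterm q a b u v t) - sumZ (theta_term q t)) <= r * K)%R.
Proof.
  intros Hq Ht HA HB H1 H2.
  destruct (bterm_majorant q u v t A B) as (M & HM & H); try assumption.
  pose proof (theta_summable q t Hq Ht) as Hth.
  assert (HK : forall (r : R) (a b : C), (0 <= r <= 1)%R ->
    (Cmod a <= r * A)%R -> (Cmod b <= r * B)%R ->
    is_bilateral_series (bterm q a b u v t) (sumZ (bterm q a b u v t)) /\
    (Cmod (sumZ (bterm q a b u v t) - sumZ (theta_term q t)) <= r * massZ M)%R).
  { intros r a b Hr Ha Hb.
    set (d := fun k => bterm q a b u v t k - theta_term q t k).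
    assert (Hd : forall k, (Cmod (d k) <= r * M k)%R)
      by exact (fun k => proj1 (H r a b k Hr Ha Hb)).
    destruct (bilateral_dominated d (fun k => r * M k)%R Hd) as (l & Hl & _).
    { destruct HM. split; apply (ex_series_scal_l (V := R_NormedModule) r); assumption. }
    assert (Hs : is_bilateral_series (bterm q a b u v t) (l + sumZ (theta_term q t))).
    { eapply bilateral_ext; [|exact (bilateral_plus _ _ _ _ Hl Hth)].
      intros k. unfold d. ring. }
    rewrite (sumZ_unique _ _ Hs). split; [exact Hs|].
    replace (l + _ - _) with l by ring.
    apply (bilateral_le d M r l); assumption. }
  exists (massZ M). split; [|exact HK].
  destruct (HK 1%R 0 0) as [_ Hb]; [lra|rewrite Cmod_0; lra|rewrite Cmod_0; lra|].
  pose proof (Cmod_ge_0 (sumZ (bterm q 0 0 u v t) - sumZ (theta_term q t))). lra.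
Qed.

(** Peeling a factor off the second product of F leaves G and a sum with v = t = z q; the latter is
    F(a q, b) with its index shifted by one. *)
Lemma sum_relation_v (q z a b F F' G : C) :
  (0 < Cmod q < 1)%R -> q <> 0 -> z <> 0 ->
  is_bilateral_series (bterm q a b q z z) F ->
  is_bilateral_series (bterm q (a * q) b q z z) F' ->
  is_bilateral_series (bterm q a b q (z * q) z) G ->
  F = (1 - z * a) * G + b * F'.
Proof.
  intros Hq Hq0 Hz HF HF' HG.
  apply (bilateral_unique _ _ _ HF).
  eapply bilateral_ext;
    [|exact (bilateral_plus _ _ _ _ (bilateral_scal (1 - z * a) _ _ HG)
        (bilateral_scal b _ _ (bilateral_shift _ _ HF')))].
  intros k. simpl.
  rewrite bterm_shift, bterm_scale, (bterm_peel_v q a b q z z) by assumption.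
  replace (q / q * q) with q by (field; exact Hq0). ring.
Qed.

(** Peeling a factor off the first product of G gives u = q^2. Scaling (a, b) by q restores u = q in
    one part; in the other the shift of k does so, which is why G and F are shifted here and [G'] is
    not. *)
Lemma sum_relation_u (q z a b F G G' : C) :
  (0 < Cmod q < 1)%R -> q <> 0 -> z <> 0 ->
  is_bilateral_series (bterm q a b q (z * q) z) G ->
  is_bilateral_series (bterm q (a * q) (b * q) q z z) F ->
  is_bilateral_series (bterm q a (b * q) q (z * q) z) G' ->
  G = (1 - q * b) * F + a * z * G'.
Proof.
  intros Hq Hq0 Hz HG HF HG'.
  assert (Hzq : z / q <> 0) by (apply Cmult_neq_0; [exact Hz|apply Cinv_nz, Hq0]).
  apply bilateral_shift in HG.
  apply (bilateral_unique _ _ _ HG).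
  eapply bilateral_ext;
    [|exact (bilateral_plus _ _ _ _
        (bilateral_scal (1 - q * b) _ _ (bilateral_shift _ _ HF))
        (bilateral_scal (a * z) _ _ HG'))].
  intros k. simpl.
  rewrite bterm_scale, (bterm_peel_u q a b q (z * q) z (k + 1)) by assumption.
  rewrite (bterm_shift q a b (q * q) (z * q) (z / q)) by assumption.
  replace (q * q / q) with q by (field; exact Hq0).
  replace (z / q * q) with z by (field; exact Hq0).
  field. exact Hq0.
Qed.

Lemma bterm_sum_theta (q a b z : C) :
  (0 < Cmod q < 1)%R -> z <> 0 -> (Cmod (a * z) < 1)%R -> (Cmod b < 1)%R ->
  exists l, is_bilateral_series (bterm q a b q z z) l /\
    (1 - b) * l = sumZ (theta_term q z).
Proof.
  intros Hq Hz Haz Hb.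
  assert (Hq0 : q <> 0) by (apply Cmod_gt_0; lra).
  assert (Hzp : (0 < Cmod z)%R) by (apply Cmod_gt_0, Hz).
  rewrite Cmod_mult in Haz.
  pose proof (Cmod_ge_0 a) as Ha0. pose proof (Cmod_ge_0 b) as Hb0.
  assert (Hc1 : (Cmod z * (Cmod q * Cmod a) < Cmod q)%R).
  { replace (Cmod z * (Cmod q * Cmod a))%R
      with (Cmod q * (Cmod a * Cmod z))%R by ring. nra. }
  destruct (bterm_sums q q z z (Cmod a) (Cmod b)) as (K1 & HK1 & H1);
    try assumption; [nra|].
  destruct (bterm_sums q q (z * q) z (Cmod a) (Cmod b)) as (K2 & HK2 & H2);
    try assumption.
  { rewrite Cmod_mult. assert (Cmod q * Cmod b < 1)%R by nra. nra. }
  set (P := sumZ (theta_term q z)) in *.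
  pose proof (Cmod_ge_0 P) as HP.
  set (F := fun a b => sumZ (bterm q a b q z z)).
  set (G := fun a b => sumZ (bterm q a b q (z * q) z)).
  assert (HF : forall x y, (Cmod x <= Cmod a)%R -> (Cmod y <= Cmod b)%R ->
            is_bilateral_series (bterm q x y q z z) (F x y)).
  { intros x y Hx Hy. refine (proj1 (H1 1%R x y _ _ _)); lra. }
  assert (HG : forall x y, (Cmod x <= Cmod a)%R -> (Cmod y <= Cmod b)%R ->
            is_bilateral_series (bterm q x y q (z * q) z) (G x y)).
  { intros x y Hx Hy. refine (proj1 (H2 1%R x y _ _ _)); lra. }
  assert (Hs : forall (x : C) s, (Cmod x <= s)%R -> (Cmod (x * q) <= s)%R).
  { intros x s Hx. rewrite Cmod_mult. pose proof (Cmod_ge_0 x). nra. }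
  assert (HD : (1 - b) * F a b - P = 0).
  (* The maximum bounds both contraction factors. In the last constant, 2 K2 + |P| serves the
     boundedness of the second unknown and 2 K1 + |P| the Lipschitz bound of the first. *)
  { refine (system_vanishes q z (fun x y => (1 - y) * F x y - P)
      (fun x y => (1 - z * x) * G x y - P) (Cmod a) (Cmod b)
      (Rmax (Cmod a * Cmod z) (Cmod b)) (2 * K1 + 2 * K2 + Cmod P)
      Hq Ha0 Hb0 (Rmax_l _ _) (Rmax_r _ _) _ _ _ _ _ a b _ _).
    - apply Rmax_lub_lt; assumption.
    - intros x y Hx Hy.
      rewrite (sum_relation_v q z x y (F x y) (F (x * q) y) (G x y)) by auto.
      ring.
    - intros x y Hx Hy.
      rewrite (sum_relation_u q z x y (F (x * q) (y * q)) (G x y) (G x (y * q)))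
        by auto.
      ring.
    - intros x y Hx Hy.
      destruct (H2 1%R x y) as [_ HB]; [lra|lra|lra|]. fold (G x y) in HB. fold P in HB.
      replace ((1 - z * x) * G x y - P)
        with ((1 - z * x) * (G x y - P) - z * x * P) by ring.
      assert (Hzx : (Cmod (z * x) <= 1)%R).
      { rewrite Cmod_mult. nra. }
      assert (H1zx : (Cmod (1 - z * x) <= 2)%R).
      { eapply Rle_trans; [apply Cmod_triangle_minus|]. rewrite Cmod_1. lra. }
      eapply Rle_trans; [apply Cmod_triangle_minus|].
      rewrite (Cmod_mult (1 - _)), (Cmod_mult (z * x)).
      pose proof (Cmod_ge_0 (G x y - P)). pose proof (Cmod_ge_0 (1 - z * x)).
      pose proof (Cmod_ge_0 (z * x)). nra.
    - intros r x y Hr Hx Hy.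
      destruct (H1 r x y) as [_ HB]; [lra|lra|lra|]. fold (F x y) in HB. fold P in HB.
      (* Each piece must carry a factor [r]: F - P by the Lipschitz estimate, the other because |y|
         <= r |b| <= r. *)
      replace ((1 - y) * F x y - P)
        with ((F x y - P) - y * ((F x y - P) + P)) by ring.
      assert (Hy1 : (Cmod y <= r)%R) by nra.
      assert (HFP : (Cmod (F x y - P + P) <= K1 + Cmod P)%R).
      { eapply Rle_trans; [apply Cmod_triangle|]. nra. }
      eapply Rle_trans; [apply Cmod_triangle_minus|]. rewrite Cmod_mult.
      assert (Cmod y * Cmod (F x y - P + P) <= r * (K1 + Cmod P))%R.
      { apply Rmult_le_compat; try apply Cmod_ge_0; assumption. }
      nra.
    - lra.
    - lra. }
  exists (F a b). split; [apply HF; lra|].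
  replace ((1 - b) * F a b) with ((1 - b) * F a b - P + P) by ring.
  rewrite HD. ring.
Qed.

(** * Euler's expansion and the Jacobi triple product *)

(** Euler's term (-1)^n q^(n(n-1)/2) x^n / (q; q)_n multiplied by (q; q)_oo. This avoids division
    and is the form in which the terms arise from [bterm]. *)
Definition euler_term (q x : C) (n : nat) : C :=
  qpoch (q ^ S n) q * theta_term q x (Z.of_nat n).

Lemma qpoch_inv_pow (q : C) (m : nat) : (0 < Cmod q < 1)%R -> qpoch (/ q ^ m) q = 0.
Proof.
  intros Hq. assert (Hq0 : q <> 0) by (apply Cmod_gt_0; lra).
  induction m as [|m IH].
  - rewrite qpoch_step by exact Hq. simpl. field.
  - rewrite qpoch_step by exact Hq.
    replace (/ q ^ S m * q) with (/ q ^ m).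
    + rewrite IH. ring.
    + rewrite Cpow_S. field. auto using Cpow_nz.
Qed.

Lemma Cmod_qpoch_le (x q : C) :
  (0 < Cmod q < 1)%R -> (Cmod x <= 1)%R -> (Cmod (qpoch x q) <= exp (/ (1 - Cmod q)))%R.
Proof.
  intros Hq Hx.
  replace (qpoch x q) with (qpoch x q - 0) by ring.
  apply (Cmod_limit_le (qpoch_n x q)); [apply qpoch_filterlim, Hq|].
  intros n. replace (qpoch_n x q n - 0) with (qpoch_n x q n) by ring.
  eapply Rle_trans; [apply Cmod_qpoch_n_le|].
  eapply Rle_trans; [apply rpoch_le_exp; [apply Cmod_ge_0|exact Hq]|].
  apply exp_le. unfold Rdiv.
  assert (0 < / (1 - Cmod q))%R by (apply Rinv_0_lt_compat; lra). nra.
Qed.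

Lemma euler_term_majorant (q x : C) :
  (0 < Cmod q < 1)%R -> x <> 0 ->
  exists M : nat -> R, ex_series M /\ forall n, (Cmod (euler_term q x n) <= M n)%R.
Proof.
  intros Hq Hx.
  destruct (bterm_majorant q 0 0 x 0 0) as (M & [HM _] & H); try assumption; try lra.
  { rewrite Rmult_0_r. apply Cmod_gt_0, Hx. }
  exists (fun n => exp (/ (1 - Cmod q)) * M (Z.of_nat n))%R. split.
  - apply (ex_series_scal_l (V := R_NormedModule)). exact HM.
  - intros n. unfold euler_term. rewrite Cmod_mult.
    apply Rmult_le_compat; try apply Cmod_ge_0.
    + apply Cmod_qpoch_le; [exact Hq|]. rewrite Cmod_pow.
      rewrite <- (pow1 (S n)). apply pow_incr. lra.
    + refine (proj2 (H 0%R 0 0 _ _ _ _)); rewrite ?Cmod_0; lra.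
Qed.

(** Termwise, (q^(n+1))_oo (1 - q^n) = (q^n)_oo, so E - E' has these products as coefficients. Its
    term at n = 0 vanishes since (1)_oo = 0, and reindexing gives - x E'. *)
Lemma euler_step (q x E E' : C) :
  (0 < Cmod q < 1)%R -> x <> 0 ->
  is_series (V := C_NormedModule) (euler_term q x) E ->
  is_series (V := C_NormedModule) (euler_term q (x * q)) E' ->
  E = (1 - x) * E'.
Proof.
  intros Hq Hx HE HE'. assert (Hq0 : q <> 0) by (apply Cmod_gt_0; lra).
  assert (Hd : is_series (V := C_NormedModule)
            (fun n => qpoch (q ^ n) q * theta_term q x (Z.of_nat n)) (E - E')).
  { eapply (is_series_ext (V := C_NormedModule));
      [|exact (is_series_minus (V := C_NormedModule) _ _ _ _ HE HE')].
    intros n. unfold euler_term. rewrite theta_term_mulq, Cpowz_nat by assumption.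
    rewrite (qpoch_step (q ^ n)) by exact Hq.
    replace (q ^ n * q) with (q ^ S n) by (rewrite Cpow_S; ring).
    unfold plus, opp; simpl. ring. }
  assert (Hd' : is_series (V := C_NormedModule)
            (fun n => qpoch (q ^ n) q * theta_term q x (Z.of_nat n)) (- x * E')).
  { apply (is_series_decr_1 (V := C_NormedModule)).
    replace (plus _ _) with (- x * E').
    2:{ unfold plus, opp; simpl.
        rewrite (qpoch_step 1) by exact Hq. ring. }
    eapply (is_series_ext (V := C_NormedModule));
      [|exact (is_series_scal (V := C_NormedModule) (- x) _ _ HE')].
    intros n. rewrite Nat2Z.inj_succ, <- Z.add_1_r, theta_term_shift by assumption.
    unfold euler_term, scal; simpl; unfold mult; simpl. ring. }
  pose proof (is_series_C_unique _ _ _ Hd Hd') as Heq.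
  replace E with (E - E' + E') by ring. rewrite Heq. ring.
Qed.

Lemma theta_term_pow (q x : C) (N n : nat) :
  q <> 0 -> x <> 0 ->
  theta_term q (x * q ^ N) (Z.of_nat n) = q ^ (n * N) * theta_term q x (Z.of_nat n).
Proof.
  intros Hq Hx. unfold theta_term. rewrite !Cpowz_nat, Cpow_mult_l, <- Cpow_mult_r.
  rewrite (Nat.mul_comm N n). ring.
Qed.

(** Iterating [euler_step] gives E = (x; q)_N E_N, where E_N is the sum at x q^N. The term n = 0 of
    E_N is (q; q)_oo and the others gain q^(n N), so E_N tends to (q; q)_oo. *)
Lemma euler_sum (q x : C) :
  (0 < Cmod q < 1)%R -> x <> 0 ->
  is_series (V := C_NormedModule) (euler_term q x) (qpoch q q * qpoch x q).
Proof.
  intros Hq Hx. assert (Hq0 : q <> 0) by (apply Cmod_gt_0; lra).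
  assert (Hex : forall y : C, y <> 0 -> exists E : C,
            is_series (V := C_NormedModule) (euler_term q y) E).
  { intros y Hy. destruct (euler_term_majorant q y Hq Hy) as (M & HM & H).
    destruct (series_dominated _ M H HM) as (E & HE & _). exists E; exact HE. }
  assert (HxN : forall N, x * q ^ N <> 0).
  { intros N. apply Cmult_neq_0; [exact Hx|apply Cpow_nz, Hq0]. }
  destruct (Hex x Hx) as [E HE].
  assert (Hiter : forall N (E' : C), is_series (V := C_NormedModule)
            (euler_term q (x * q ^ N)) E' -> E = qpoch_n x q N * E').
  { induction N as [|N IH]; intros E' HE'.
    - simpl in HE' |- *. replace (x * 1) with x in HE' by ring.
      rewrite (is_series_C_unique _ _ _ HE HE'). ring.
    - destruct (Hex _ (HxN N)) as [E'' HE''].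
      rewrite (IH _ HE'').
      replace (x * q ^ S N) with (x * q ^ N * q) in HE' by (rewrite Cpow_S; ring).
      rewrite (euler_step q _ _ _ Hq (HxN N) HE'' HE'). simpl. ring. }
  destruct (euler_term_majorant q x Hq Hx) as (M & HM & H).
  assert (HM' : ex_series (fun n => M (S n)))
    by exact (proj1 (ex_series_incr_1 (V := R_NormedModule) M) HM).
  set (K := Series (fun n => M (S n))).
  assert (HK : forall N (E' : C), is_series (V := C_NormedModule)
            (euler_term q (x * q ^ N)) E' ->
            (Cmod (E' - qpoch q q) <= Cmod q ^ N * K)%R).
  { intros N E' HE'.
    destruct (series_dominated (fun n => euler_term q (x * q ^ N) (S n))
                (fun n => Cmod q ^ N * M (S n))%R) as (l & Hl & Hb).
    - intros n. unfold euler_term. rewrite theta_term_pow by assumption.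
      replace (qpoch (q ^ S (S n)) q * (q ^ (S n * N) * theta_term q x (Z.of_nat (S n))))
        with (q ^ (S n * N) * euler_term q x (S n)) by (unfold euler_term; ring).
      rewrite Cmod_mult, Cmod_pow.
      apply Rmult_le_compat; [apply pow_le, Cmod_ge_0|apply Cmod_ge_0| |apply H].
      simpl. rewrite pow_add.
      assert (0 < Cmod q ^ N)%R by (apply pow_lt; lra).
      assert (Cmod q ^ (n * N) <= 1)%R
        by (rewrite <- (pow1 (n * N)); apply pow_incr; lra).
      nra.
    - apply (ex_series_scal_l (V := R_NormedModule)). exact HM'.
    - rewrite Series_scal_l in Hb. fold K in Hb.
      replace (E' - qpoch q q) with l; [exact Hb|].
      apply (is_series_C_unique _ _ _ Hl).
      apply (is_series_incr_1 (V := C_NormedModule) (euler_term q (x * q ^ N))).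
      replace (plus _ _) with E'; [exact HE'|].
      unfold plus, euler_term, theta_term; simpl.
      replace (q * 1) with q by ring. ring. }
  replace (qpoch q q * qpoch x q) with E; [exact HE|].
  set (C0 := exp (Cmod x / (1 - Cmod q))).
  apply (filterlim_C_unique (fun N => qpoch q q * qpoch_n x q N)).
  - apply filterlim_dominated with (fun N => Cmod q ^ N * (C0 * K))%R.
    + intros N. destruct (Hex _ (HxN N)) as [E' HE'].
      rewrite (Hiter N E' HE').
      replace (qpoch q q * qpoch_n x q N - qpoch_n x q N * E')
        with (- (qpoch_n x q N * (E' - qpoch q q))) by ring.
      rewrite Cmod_opp, Cmod_mult.
      apply Rle_trans with (C0 * (Cmod q ^ N * K))%R; [|right; ring].
      apply Rmult_le_compat; try apply Cmod_ge_0; [|apply HK, HE'].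
      eapply Rle_trans; [apply Cmod_qpoch_n_le|].
      apply rpoch_le_exp; [apply Cmod_ge_0|exact Hq].
    + replace (Finite 0) with (Finite (0 * (C0 * K))) by (f_equal; ring).
      apply (is_lim_seq_mult' (fun n => Cmod q ^ n)%R (fun _ => C0 * K)%R 0 _);
        [|apply is_lim_seq_const].
      apply is_lim_seq_geom. rewrite Rabs_pos_eq; lra.
  - apply filterlim_Cmult_l, qpoch_filterlim, Hq.
Qed.

(* For [a = 1], [b = 0] the factor [(q^(1-k))_oo] kills the terms with [k > 0], and the
   remaining ones form Euler's series for [(q/z)_oo]. *)
Lemma jacobi_triple_disc (q z : C) :
  (0 < Cmod q < 1)%R -> z <> 0 -> (Cmod z < 1)%R ->
  sumZ (theta_term q z) = qpoch q q * qpoch z q * qpoch (q / z) q.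
Proof.
  intros Hq Hz Hz1. assert (Hq0 : q <> 0) by (apply Cmod_gt_0; lra).
  destruct (bterm_sum_theta q 1 0 z Hq Hz) as (l & Hl & <-).
  { rewrite Cmult_1_l. exact Hz1. }
  { rewrite Cmod_0. lra. }
  replace ((1 - 0) * l) with l by ring.
  assert (Hqz : q / z <> 0) by (apply Cmult_neq_0; [exact Hq0|apply Cinv_nz, Hz]).
  pose proof (euler_sum q (q / z) Hq Hqz) as HE.
  assert (Hterm : forall k, bterm q 1 0 q z z k
            = qpoch z q * (qpoch (q * Cpowz q (- k)) q * theta_term q z k)).
  { intros k. unfold bterm.
    replace (q * Cpowz q (- k) * (1 + 0 * Cpowz q k)) with (q * Cpowz q (- k)) by ring.
    replace (z * (1 + 0 * Cpowz q k)) with z by ring. ring. }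
  apply (bilateral_unique _ _ _ Hl).
  exists (qpoch z q * qpoch q q),
    (qpoch z q * (qpoch q q * qpoch (q / z) q - qpoch q q)).
  repeat split.
  (* The term k = 0 is the whole sum of this half; the remaining zero terms are summed as 0 times
     Euler's series. *)
  - apply (is_series_decr_1 (V := C_NormedModule)).
    replace (plus _ _) with (scal (V := C_NormedModule) (RtoC 0)
      (qpoch q q * qpoch (q / z) q)).
    2:{ rewrite Hterm. unfold plus, opp, scal, theta_term; simpl; unfold mult; simpl.
        replace (q * 1) with q by ring. ring. }
    eapply (is_series_ext (V := C_NormedModule));
      [|exact (is_series_scal (V := C_NormedModule) (RtoC 0) _ _ HE)].
    intros n. rewrite Hterm, Cpowz_neg_nat.
    replace (q * / q ^ S n) with (/ q ^ n)
      by (rewrite Cpow_S; field; auto using Cpow_nz).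
    rewrite qpoch_inv_pow by exact Hq.
    unfold scal; simpl; unfold mult; simpl. ring.
  - assert (HE' : is_series (V := C_NormedModule)
              (fun n => euler_term q (q / z) (S n))
              (qpoch q q * qpoch (q / z) q - qpoch q q)).
    { apply (is_series_incr_1 (V := C_NormedModule) (euler_term q (q / z))).
      replace (plus _ _) with (qpoch q q * qpoch (q / z) q); [exact HE|].
      unfold plus, euler_term, theta_term; simpl.
      replace (q * 1) with q by ring. ring. }
    eapply (is_series_ext (V := C_NormedModule));
      [|exact (is_series_scal (V := C_NormedModule) (qpoch z q) _ _ HE')].
    intros n. rewrite Hterm, theta_term_opp, Z.opp_involutive, Cpowz_nat by assumption.
    reflexivity.
  - ring.
Qed.

(** The specialization a = 1 forces |z| < 1, whereas the final identity allows large z when a is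
    small. Both sides acquire the same factor - z when z q is replaced by z, so finitely many steps
    reach the disc. *)
Lemma jacobi_triple (q z : C) :
  (0 < Cmod q < 1)%R -> z <> 0 ->
  sumZ (theta_term q z) = qpoch q q * qpoch z q * qpoch (q / z) q.
Proof.
  intros Hq Hz. assert (Hq0 : q <> 0) by (apply Cmod_gt_0; lra).
  assert (Hzp : (0 < Cmod z)%R) by (apply Cmod_gt_0, Hz).
  assert (HN : exists N, (Cmod z * Cmod q ^ N < 1)%R).
  { destruct (pow_lt_1_zero (Cmod q)) with (y := (/ Cmod z)%R) as [N HN].
    - rewrite Rabs_pos_eq; lra.
    - apply Rinv_0_lt_compat, Hzp.
    - exists N. specialize (HN N (le_n N)).
      rewrite Rabs_pos_eq in HN by (apply pow_le; lra).
      apply (Rmult_lt_compat_l (Cmod z)) in HN; [|exact Hzp].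
      rewrite Rinv_r in HN; lra. }
  destruct HN as [N HN]. clear Hzp. revert z Hz HN.
  induction N as [|N IH]; intros z Hz HN.
  - simpl in HN. apply jacobi_triple_disc; [exact Hq|exact Hz|lra].
  - assert (Hzq : z * q <> 0) by (apply Cmult_neq_0; assumption).
    specialize (IH (z * q) Hzq).
    rewrite Cmod_mult, Rmult_assoc in IH. specialize (IH HN).
    assert (Hs : sumZ (theta_term q z) = - z * sumZ (theta_term q (z * q))).
    { apply sumZ_unique.
      pose proof (bilateral_shift _ _ (theta_summable q z Hq Hz)) as H1.
      pose proof (bilateral_scal (- z) _ _ (theta_summable q (z * q) Hq Hzq)) as H2.
      replace (- z * sumZ (theta_term q (z * q))) with (sumZ (theta_term q z)).
      - apply theta_summable; assumption.
      - apply (bilateral_unique _ _ _ H1). eapply bilateral_ext; [|exact H2].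
        intros k. symmetry. apply theta_term_shift; assumption. }
    rewrite Hs, IH, (qpoch_step z), (qpoch_step (q / (z * q))) by exact Hq.
    replace (q / (z * q) * q) with (q / z) by (field; auto).
    field. auto.
Qed.

Theorem theorem4p1 (q a b z : C)
  (hq : (0 < Cmod q < 1)%R)
  (hz : z <> 0)
  (hb : b <> 1)
  (hab : (Rmax (Cmod (a * z)) (Cmod b) < 1)%R) :
  is_bilateral_series
    (fun k : Z =>
       qpoch (a * Cpowz q (1 - k) + b * q) q *
       qpoch (z * (a + b * Cpowz q k)) q *
       Cpowz (-1) k * Cpowz q (binom2 k) * Cpowz z k)
    (qpoch q q * qpoch z q * qpoch (q / z) q / (1 - b)).
Proof.
  assert (hq0 : q <> 0) by (apply Cmod_gt_0; lra).
  apply Rmax_Rlt in hab as [haz hb1].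
  destruct (bterm_sum_theta q a b z hq hz haz hb1) as (l & hl & heq).
  rewrite jacobi_triple in heq by assumption.
  assert (h1b : 1 - b <> 0).
  { intros h. apply hb. replace b with (1 - (1 - b)) by ring. rewrite h. ring. }
  rewrite <- heq. replace ((1 - b) * l / (1 - b)) with l by (field; exact h1b).
  eapply bilateral_ext; [|exact hl].
  intros k. unfold bterm, theta_term.
  replace (1 - k)%Z with (1 + - k)%Z by ring.
  rewrite Cpowz_add, Cpowz_opp by exact hq0.
  replace (Cpowz q 1) with q by (simpl; ring).
  (* For u = q the first argument of [bterm] is exactly a q^(1-k) + b q. *)
  replace (q * / Cpowz q k * (a + b * Cpowz q k))
    with (a * (q * / Cpowz q k) + b * q) by (field; apply Cpowz_nz, hq0).
  ring.
Qed.
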